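(* Let $d_x,d_y\in\mathbb{N}$, let $L>0$, and let $f:\mathbb{R}^{d_x}\times\mathbb{R}^{d_y}\to\mathbb{R}$ be an $L$-smooth, convex-concave function with saddle point $z^*=(x^*,y^* )$. For any initialization $z_0=(x_0,y_0)\in\mathbb{R}^{d_x}\times\mathbb{R}^{d_y}$ and any number of iterations $T\in\mathbb{N}$, $T\ge 1$, the iterates $z_t=(x_t,y_t)$ of alternating gradient-descent-ascent with momentum, $$x_{t+1}=x_t-\eta\nabla_x f(x_t,y_t)+\beta(x_t-x_{t-1}),\qquad y_{t+1}=y_t+\eta\nabla_y f(x_{t+1},y_t)+\beta(y_t-y_{t-1})\qquad (t\ge 0),$$ with $x_{-1}:=x_0$, $y_{-1}:=y_0$, stepsize $\eta=\frac{1}{5L}$ and negative momentum $\beta=-\frac12$, satisfy $$\frac1T\sum_{t=0}^{T-1}\|\nabla f(z_t)\|^2\le\frac{12\,\|z_0-z^*\|^2}{\eta^2 T}.$$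
   Context: All norms are Euclidean. A differentiable function $f$ is $L$-smooth if $\|\nabla f(a)-\nabla f(b)\|\le L\|a-b\|$ for all $a,b$ (here $\nabla f=(\nabla_x f,\nabla_y f)$ is the full gradient on $\mathbb{R}^{d_x}\times\mathbb{R}^{d_y}$). $f$ is convex-concave if $f(\cdot,y)$ is convex for every $y$ and $f(x,\cdot)$ is concave for every $x$. A saddle point $(x^*,y^* )$ is a point with $f(x^*,y)\le f(x^*,y^* )\le f(x,y^* )$ for all $x,y$; for convex-concave differentiable $f$ this is equivalent to $\nabla f(x^*,y^* )=0$. Note that the $y$-update uses the already updated $x_{t+1}$. *)

(* Defs.v *)
From HB Require Import structures.
From mathcomp Require Import all_boot all_order all_algebra.
From mathcomp Require Import all_classical all_reals all_analysis.

Set Implicit Arguments.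
Unset Strict Implicit.
Unset Printing Implicit Defensive.

Import Order.TTheory GRing.Theory Num.Theory.
Import numFieldNormedType.Exports.

Local Open Scope ring_scope.

(* The norms [`| _ |] that the library puts on row vectors and on pairs are
   max-norms; they induce the Euclidean topology, so [differentiable] and ['D_v]
   may be used as they are, but the Euclidean norm has to be defined. *)
Definition enorm (R : realType) (n : nat) (v : 'rV[R]_n) : R :=
  Num.sqrt (\sum_(i < n) v ord0 i ^+ 2).

Definition enorm2 (R : realType) (dx dy : nat)
    (z : 'rV[R]_dx * 'rV[R]_dy) : R :=
  Num.sqrt (enorm z.1 ^+ 2 + enorm z.2 ^+ 2).

Definition gradient (R : realType) (n : nat) (g : 'rV[R]_n -> R)
    (p : 'rV[R]_n) : 'rV[R]_n :=
  \row_(i < n) 'D_(delta_mx ord0 i) g p.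

Definition grad_x (R : realType) (dx dy : nat)
    (f : 'rV[R]_dx * 'rV[R]_dy -> R) (z : 'rV[R]_dx * 'rV[R]_dy) :
    'rV[R]_dx :=
  gradient (fun x => f (x, z.2)) z.1.

Definition grad_y (R : realType) (dx dy : nat)
    (f : 'rV[R]_dx * 'rV[R]_dy -> R) (z : 'rV[R]_dx * 'rV[R]_dy) :
    'rV[R]_dy :=
  gradient (fun y => f (z.1, y)) z.2.

Definition grad (R : realType) (dx dy : nat)
    (f : 'rV[R]_dx * 'rV[R]_dy -> R) (z : 'rV[R]_dx * 'rV[R]_dy) :
    'rV[R]_dx * 'rV[R]_dy :=
  (grad_x f z, grad_y f z).

Definition smooth (R : realType) (dx dy : nat) (L : R)
    (f : 'rV[R]_dx * 'rV[R]_dy -> R) : Prop :=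
  (forall z, differentiable f z) /\
  (forall a b, enorm2 (grad f a - grad f b) <= L * enorm2 (a - b)).

Definition convex_concave (R : realType) (dx dy : nat)
    (f : 'rV[R]_dx * 'rV[R]_dy -> R) : Prop :=
  (forall y, convex_function setT (fun x : 'rV[R]_dx => f (x, y))) /\
  (forall x, convex_function setT (fun y : 'rV[R]_dy => - f (x, y))).

Definition saddle_point (R : realType) (dx dy : nat)
    (f : 'rV[R]_dx * 'rV[R]_dy -> R) (zs : 'rV[R]_dx * 'rV[R]_dy) : Prop :=
  forall x y, f (zs.1, y) <= f zs /\ f zs <= f (x, zs.2).

(* [z t] is (x_t, y_t). The convention z_{-1} := z_0 is encoded by the truncated
   predecessor: [t.-1] is 0 for t = 0. *)
Definition alt_gda_momentum (R : realType) (dx dy : nat)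
    (f : 'rV[R]_dx * 'rV[R]_dy -> R) (eta beta : R)
    (z : nat -> 'rV[R]_dx * 'rV[R]_dy) : Prop :=
  forall t : nat,
    (z t.+1).1 = (z t).1 - eta *: grad_x f (z t)
                 + beta *: ((z t).1 - (z t.-1).1) /\
    (z t.+1).2 = (z t).2 + eta *: grad_y f ((z t.+1).1, (z t).2)
                 + beta *: ((z t).2 - (z t.-1).2).

(* Main.v *)
Require Import Defs.
From mathcomp Require Import all_boot all_order all_algebra.
From mathcomp Require Import all_classical all_reals all_analysis.
From mathcomp Require Import ring lra.

Import Order.TTheory GRing.Theory Num.Theory.
Import numFieldNormedType.Exports.

Local Open Scope ring_scope.

(** Why the theorem holds.

Put [phi = eta f], [G = eta grad_x f], [H = eta grad_y f], so that the gradient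
of [phi] is Lipschitz with constant [1/5] and the stepsize disappears. Write
[D_t = z_t - z_(t-1)] and [F_t = (G (x_t, y_t), - H (x_(t+1), y_t))]; the
iteration reads [D_(t+1) = - D_t / 2 - F_t].

The average [z_t - D_t / 3 = (2 z_t + z_(t-1)) / 3] performs a plain step
[- (2/3) F_t], and its squared distance to the saddle changes by
[- (4/3) <F_t, z_t - z*>] plus multiples of [|D_t|^2] and [|D_(t+1)|^2]
([averaged_dist_step]). Convexity and concavity bound
[- <F_t, z_t - z*>] by [phi (x_(t+1), y_t) - phi (x_t, y_t)], a difference created
by the alternation of the updates: it is the change of [phi] along an x-step, to
first order [- |v|^2 - <v', v> / 2] for the x-increment [v] and the preceding one
[v']. Half of it is traded, by telescoping [phi (z_t)], for
[phi (x_(t+1), y_t) - phi (x_(t+1), y_(t+1))], which has the same form in the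
y-increments. Altogether [energy] changes by negative multiples of [|D_t|^2],
[|D_(t+1)|^2] and [<D_t, D_(t+1)>] ([energy_step]).

This change can be positive when successive increments have opposite directions, but
such an alternation would need [F_t] to oscillate, while
[F_t - F_(t-1) = - (D_(t+1) - D_t / 2 - D_(t-1) / 2)] is controlled by the
Lipschitz bound. Adding this inequality with weight [1/2], and storing
[|D_t|^2 / 10 + |D_(t-1)|^2 / 8] in [potential], leaves a negative definite
quadratic form in three successive increments ([potential_form]), with enough
room to absorb [1/9] of the squared gradient at [z_t] ([potential_step]).
The potential is nonnegative ([potential_ge0]); at time 1 it is at most
[(4/3) |z_0 - z*|^2] minus the first gradient term ([potential_first]). Summing
gives the constant [12 = 9 * 4/3] ([sum_grad_le]). *)

(** * Euclidean inner product *)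

Definition dot {R : realType} {n : nat} (u v : 'rV[R]_n) : R :=
  \sum_(i < n) u ord0 i * v ord0 i.

Definition sqn {R : realType} {n : nat} (u : 'rV[R]_n) : R := dot u u.

Lemma dotC {R : realType} {n : nat} (u v : 'rV[R]_n) : dot u v = dot v u.
Proof. by apply: eq_bigr => i _; rewrite mulrC. Qed.

Lemma dotDl {R : realType} {n : nat} (u v w : 'rV[R]_n) :
  dot (u + v) w = dot u w + dot v w.
Proof. by rewrite -big_split; apply: eq_bigr => i _; rewrite mxE mulrDl. Qed.

Lemma dotZl {R : realType} {n : nat} (a : R) (u v : 'rV[R]_n) :
  dot (a *: u) v = a * dot u v.
Proof. by rewrite mulr_sumr; apply: eq_bigr => i _; rewrite mxE mulrA. Qed.

Lemma dotNl {R : realType} {n : nat} (u v : 'rV[R]_n) : dot (- u) v = - dot u v.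
Proof. by rewrite -scaleN1r dotZl mulN1r. Qed.

Lemma dotDr {R : realType} {n : nat} (u v w : 'rV[R]_n) :
  dot u (v + w) = dot u v + dot u w.
Proof. by rewrite !(dotC u) dotDl. Qed.

Lemma dotZr {R : realType} {n : nat} (a : R) (u v : 'rV[R]_n) :
  dot u (a *: v) = a * dot u v.
Proof. by rewrite !(dotC u) dotZl. Qed.

Lemma dotNr {R : realType} {n : nat} (u v : 'rV[R]_n) : dot u (- v) = - dot u v.
Proof. by rewrite !(dotC u) dotNl. Qed.

Definition dotE := (@dotDl, @dotDr, @dotNl, @dotNr, @dotZl, @dotZr).

Lemma sqn_ge0 {R : realType} {n : nat} (u : 'rV[R]_n) : 0 <= sqn u.
Proof. by apply: sumr_ge0 => i _; rewrite -expr2 sqr_ge0. Qed.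

Lemma sqnN {R : realType} {n : nat} (u : 'rV[R]_n) : sqn (- u) = sqn u.
Proof. by rewrite /sqn !dotE opprK. Qed.

Lemma dot0l {R : realType} {n : nat} (u : 'rV[R]_n) : dot 0 u = 0.
Proof. by rewrite -(scale0r 0) dotZl mul0r. Qed.

Lemma sqn0 {R : realType} {n : nat} : sqn (0 : 'rV[R]_n) = 0.
Proof. exact: dot0l. Qed.

Lemma enorm_sqr {R : realType} {n : nat} (u : 'rV[R]_n) : enorm u ^+ 2 = sqn u.
Proof.
rewrite /enorm sqr_sqrtr; first by apply: eq_bigr => i _; rewrite expr2.
by apply: sumr_ge0 => i _; rewrite sqr_ge0.
Qed.

Lemma enorm2_sqr {R : realType} {dx dy : nat} (z : 'rV[R]_dx * 'rV[R]_dy) :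
  enorm2 z ^+ 2 = sqn z.1 + sqn z.2.
Proof. by rewrite /enorm2 sqr_sqrtr ?enorm_sqr// addr_ge0 ?sqn_ge0. Qed.

(** Young's inequality with the weight that balances the two terms when
[|u| = |v| / 5], the extreme case allowed by the Lipschitz constant [1/5]. *)
Lemma dot_le {R : realType} {n : nat} (u v : 'rV[R]_n) :
  dot u v <= 5 / 2 * sqn u + 1 / 10 * sqn v.
Proof. have := sqn_ge0 (5 *: u - v); rewrite /sqn !dotE (dotC v u); lra. Qed.

Lemma sqnB_le {R : realType} {n : nat} (u v : 'rV[R]_n) :
  sqn (u - v) <= 2 * sqn u + 2 * sqn v.
Proof. by have := sqn_ge0 (u + v); rewrite /sqn !dotE; lra. Qed.

(** The weights favour [v]: here [u - v] will be small compared with [v], and the loss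
on [v] must stay close to 1. *)
Lemma sqn_le_near {R : realType} {n : nat} (u v : 'rV[R]_n) :
  sqn u <= 6 / 5 * sqn v + 6 * sqn (u - v).
Proof.
have := sqn_ge0 (5 *: u - 6 *: v); rewrite /sqn !dotE (dotC v u); lra.
Qed.

(** * Gradients of convex functions *)

Lemma derive_le_of_ray {R : realType} {n : nat} (g : 'rV[R]_n -> R)
    (p v : 'rV[R]_n) (C : R) :
  differentiable g p ->
  (forall h, 0 < h -> h <= 1 -> g (p + h *: v) - g p <= h * C) ->
  'D_v g p <= C.
Proof.
move=> gp ray; have gv : derivable g p v by exact: diff_derivable.
rewrite ['D_v g p]cvg_at_rightE //; apply: limr_le.
  by apply/cvg_ex; exists ('D_v g p); apply: cvg_dnbhs_at_right; exact: gv.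
near=> h; have h0 : 0 < h by [].
rewrite /= /GRing.scale /= ler_pdivrMl // [h *: v + p]addrC; apply: ray => //.
near: h; exact: nbhs_right_le.
Unshelve. all: by end_near. Qed.

(** Linearity of the differential turns the partial derivatives that make up
[gradient] into all directional derivatives. *)
Lemma derive_gradient {R : realType} {n : nat} (g : 'rV[R]_n -> R)
    (p v : 'rV[R]_n) :
  differentiable g p -> 'D_v g p = dot (gradient g p) v.
Proof.
move=> gp; rewrite deriveE // {1}[v]row_sum_delta linear_sum.
by apply: eq_bigr => i _; rewrite linearZ /= !mxE deriveE // mulrC.
Qed.

(** The chord from [p] to [q] lies above the graph, so the difference quotients
along [q - p] are at most [g q - g p], and so is their limit. *)
Lemma gradient_convex {R : realType} {n : nat} (g : 'rV[R]_n -> R) p q :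
  convex_function setT g -> differentiable g p ->
  dot (gradient g p) (q - p) <= g q - g p.
Proof.
move=> gc gp; rewrite -derive_gradient //; apply: derive_le_of_ray => // h h0 h1.
have cvx : g (p + h *: (q - p)) <= h * g q + (1 - h) * g p.
  rewrite (_ : p + h *: (q - p) = h *: q + (1 - h) *: p).
    exact: (gc (Itv01 (ltW h0) h1) q p (in_setT _) (in_setT _)).
  by rewrite scalerBr scalerBl scale1r addrCA.
lra.
Qed.

Lemma gradient_min {R : realType} {n : nat} (g : 'rV[R]_n -> R) p :
  (forall q, g p <= g q) -> differentiable g p -> gradient g p = 0.
Proof.
move=> gmin gp; apply/rowP => i; rewrite !mxE; apply/eqP; rewrite eq_le.
have dN v : 0 <= 'D_v g p.
  rewrite -oppr_le0 -deriveN; last exact: diff_derivable.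
  apply: derive_le_of_ray; first exact: differentiableN.
  by move=> h _ _; rewrite mulr0 !fctE opprK addrC subr_le0.
rewrite dN andbT -oppr_ge0; have := dN (- delta_mx ord0 i).
by rewrite !derive_gradient // dotNr.
Qed.

(** * Rescaled first-order data and the iteration *)

Definition sqn2 {R : realType} {dx dy : nat} (z : 'rV[R]_dx * 'rV[R]_dy) : R :=
  sqn z.1 + sqn z.2.

(** What the convergence proof uses of a function multiplied by the stepsize
[1 / (5 L)]: no derivative occurs any more, and the squared Lipschitz constant is
[(eta L)^2 = 1/25]. *)
Record saddle_oracle {R : realType} {dx dy : nat}
    (phi : 'rV[R]_dx * 'rV[R]_dy -> R)
    (G : 'rV[R]_dx * 'rV[R]_dy -> 'rV[R]_dx)
    (H : 'rV[R]_dx * 'rV[R]_dy -> 'rV[R]_dy)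
    (zs : 'rV[R]_dx * 'rV[R]_dy) : Prop := SaddleOracle {
  oracle_convex : forall x x' y,
    dot (G (x, y)) (x' - x) <= phi (x', y) - phi (x, y);
  oracle_concave : forall x y y',
    phi (x, y') - phi (x, y) <= dot (H (x, y)) (y' - y);
  oracle_lipschitz : forall a b,
    sqn (G a - G b) + sqn (H a - H b) <= 1 / 25 * sqn2 (a - b);
  oracle_critical : G zs = 0 /\ H zs = 0 }.

Arguments oracle_convex {R dx dy phi G H zs}.
Arguments oracle_concave {R dx dy phi G H zs}.
Arguments oracle_lipschitz {R dx dy phi G H zs}.
Arguments oracle_critical {R dx dy phi G H zs}.

(** [v], [z], [z'] are three successive iterates; a start without momentum is the case
[v = z]. *)
Definition momentum_step {R : realType} {dx dy : nat}
    (G : 'rV[R]_dx * 'rV[R]_dy -> 'rV[R]_dx)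
    (H : 'rV[R]_dx * 'rV[R]_dy -> 'rV[R]_dy)
    (v z z' : 'rV[R]_dx * 'rV[R]_dy) : Prop :=
  z'.1 - z.1 = - ((1 / 2) *: (z.1 - v.1)) - G z /\
  z'.2 - z.2 = - ((1 / 2) *: (z.2 - v.2)) + H (z'.1, z.2).

(** The averaged point [(2 x + v) / 3] is the combination of two successive iterates
from which the momentum [- 1/2] cancels out: it moves by [- (2/3) g]. *)
Definition averaged_dist {R : realType} {n : nat} (s v x : 'rV[R]_n) : R :=
  sqn (x - (1 / 3) *: (x - v) - s).

Lemma averaged_dist_step {R : realType} {n : nat} (s v x x' g : 'rV[R]_n) :
  x' - x = - ((1 / 2) *: (x - v)) - g ->
  averaged_dist s x x' = averaged_dist s v x - 4 / 3 * dot g (x - s)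
    + 4 / 9 * sqn (x' - x) - 1 / 9 * sqn (x - v).
Proof.
move=> stepE.
have -> : g = - ((1 / 2) *: (x - v)) - (x' - x) by rewrite stepE opprB addrC subrK.
rewrite /averaged_dist /sqn !dotE.
rewrite ?(dotC x v) ?(dotC x' v) ?(dotC x' x) ?(dotC x s) ?(dotC x' s) ?(dotC v s).
lra.
Qed.

Section Oracle.
Context {R : realType} {dx dy : nat}.
Context (phi : 'rV[R]_dx * 'rV[R]_dy -> R).
Context (G : 'rV[R]_dx * 'rV[R]_dy -> 'rV[R]_dx).
Context (H : 'rV[R]_dx * 'rV[R]_dy -> 'rV[R]_dy).
Context (zs : 'rV[R]_dx * 'rV[R]_dy).
Context (oracle : saddle_oracle phi G H zs).
Implicit Types v w z : 'rV[R]_dx * 'rV[R]_dy.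

Lemma lipschitz_G a b : sqn (G a - G b) <= 1 / 25 * sqn2 (a - b).
Proof. have := oracle_lipschitz oracle a b; have := sqn_ge0 (H a - H b); lra. Qed.

Lemma lipschitz_H a b : sqn (H a - H b) <= 1 / 25 * sqn2 (a - b).
Proof. have := oracle_lipschitz oracle a b; have := sqn_ge0 (G a - G b); lra. Qed.

Lemma grad_le z : sqn (G z) + sqn (H z) <= 1 / 25 * sqn2 (z - zs).
Proof.
have := oracle_lipschitz oracle z zs.
by have [-> ->] := oracle_critical oracle; rewrite !subr0.
Qed.

(** The two saddle inequalities are those of concavity and convexity at [zs], where
the partial gradients vanish. *)
Lemma phi_le_saddle y : phi (zs.1, y) <= phi zs.
Proof.
have := oracle_concave oracle zs.1 zs.2 y.
have [_ Hs] := oracle_critical oracle.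
rewrite -surjective_pairing Hs dot0l; lra.
Qed.

Lemma phi_ge_saddle x : phi zs <= phi (x, zs.2).
Proof.
have := oracle_convex oracle zs.1 x zs.2.
have [Gs _] := oracle_critical oracle.
rewrite -surjective_pairing Gs dot0l; lra.
Qed.

(** Convexity bounds the increment by the slope at the end point; moving that slope
back to [z] costs one Lipschitz bound. *)
Lemma phi_ascent_x z x' :
  phi (x', z.2) - phi z <= dot (G z) (x' - z.1) + 1 / 5 * sqn (x' - z.1).
Proof.
have := oracle_convex oracle x' z.1 z.2.
have := lipschitz_G (x', z.2) z.
have := dot_le (G (x', z.2) - G z) (x' - z.1).
rewrite -surjective_pairing /sqn2 /= subrr sqn0.
rewrite -[z.1 - x']opprB dotNr dotDl dotNl; lra.
Qed.

Lemma phi_ascent_y z y' :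
  phi z - phi (z.1, y') <= - dot (H z) (y' - z.2) + 1 / 5 * sqn (y' - z.2).
Proof.
have := oracle_concave oracle z.1 y' z.2.
have := lipschitz_H z (z.1, y').
have := dot_le (H z - H (z.1, y')) (y' - z.2).
rewrite -surjective_pairing /sqn2 /= subrr sqn0.
rewrite -[z.2 - y']opprB dotNr sqnN dotDl dotNl; lra.
Qed.

(** Subtracting the function value shares the gain of the alternation equally between
the x-step and the y-step. *)
Definition energy v z : R :=
  averaged_dist zs.1 v.1 z.1 + averaged_dist zs.2 v.2 z.2
  - 2 / 3 * (phi z - phi zs).

(** Indefinite: it can be negative when [C] points against [B]. *)
Definition energy_rate {n : nat} (B C : 'rV[R]_n) : R :=
  4 / 45 * sqn C + 1 / 9 * sqn B + 1 / 3 * dot B C.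

(** The terms [phi (z'.1, z.2) - phi z] and [phi (z'.1, z.2) - phi z'] both appear with
weight [2/3]; each is estimated to first order, and the gradients are then
expressed through the increments. *)
Lemma energy_step v z z' : momentum_step G H v z z' ->
  energy z z' <= energy v z - energy_rate (z.1 - v.1) (z'.1 - z.1)
    - energy_rate (z.2 - v.2) (z'.2 - z.2).
Proof.
move=> [stepx stepy]; rewrite /energy /energy_rate.
have stepy' : z'.2 - z.2 = - ((1 / 2) *: (z.2 - v.2)) - (- H (z'.1, z.2)).
  by rewrite opprK.
rewrite (averaged_dist_step zs.1 _ _ _ _ stepx).
rewrite (averaged_dist_step zs.2 _ _ _ _ stepy') dotNl.
have := phi_ascent_x z z'.1; have := phi_ascent_y (z'.1, z.2) z'.2.
have := oracle_convex oracle z.1 zs.1 z.2.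
have := oracle_concave oracle z'.1 z.2 zs.2.
have := phi_le_saddle z.2; have := phi_ge_saddle z'.1.
rewrite /= -!surjective_pairing -(opprB z.1 zs.1) -(opprB z.2 zs.2) !dotNr.
have -> : dot (G z) (z'.1 - z.1) =
    - (1 / 2 * dot (z.1 - v.1) (z'.1 - z.1)) - sqn (z'.1 - z.1).
  rewrite -dotZl -dotNl -dotNl -dotDl; congr dot.
  by rewrite stepx opprB addrC subrK.
have -> : dot (H (z'.1, z.2)) (z'.2 - z.2) =
    1 / 2 * dot (z.2 - v.2) (z'.2 - z.2) + sqn (z'.2 - z.2).
  by rewrite -dotZl -dotDl stepy addrA subrr add0r.
lra.
Qed.

(** The weights [1/10] and [1/8] are chosen to make [potential_form] hold and to keep
the potential nonnegative. *)
Definition potential w v z : R :=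
  energy v z + 1 / 10 * sqn2 (z - v) + 1 / 8 * sqn2 (v - w).

(** With [A], [B], [C] three successive increments, the difference of the two sides is
[- (3/10) |C - B / 2 - (5/6) A|^2] minus positive multiples of [|A|^2], [|B|^2]
and [|C|^2]. The first line bounds the new squared gradient; the factor [1/2] in
front of the last bracket is the weight of the inequality that forbids
oscillation. *)
Lemma potential_form {n} (A B C : 'rV[R]_n) :
  1 / 9 * (6 / 5 * sqn (C + (1 / 2) *: B) + 6 / 25 * sqn C)
    + 1 / 10 * sqn C + 1 / 8 * sqn B - energy_rate B C
    + 1 / 2 * (1 / 25 * (sqn C + 2 * sqn B)
               - sqn (C - (1 / 2) *: B - (1 / 2) *: A))
  <= 1 / 10 * sqn B + 1 / 8 * sqn A.
Proof.
have := sqn_ge0 (C - (1 / 2) *: B - (5 / 6) *: A).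
have := sqn_ge0 A; have := sqn_ge0 B; have := sqn_ge0 C.
rewrite /energy_rate /sqn !dotE (dotC C B) (dotC C A) (dotC B A); lra.
Qed.

(** The second difference used in [potential_form] is exactly a difference of
successive gradients. *)
Lemma gradient_difference {n} (A B C p q : 'rV[R]_n) :
  B = - ((1 / 2) *: A) - p -> C = - ((1 / 2) *: B) - q ->
  C - (1 / 2) *: B - (1 / 2) *: A = p - q.
Proof.
move=> /rowP hB /rowP hC; apply/rowP => i.
by have := hB i; have := hC i; rewrite !mxE; lra.
Qed.

(** The Lipschitz inequality is used three times: for the two gradient differences
between consecutive steps, and for replacing [H (z'.1, z.2)] by [H z]. *)
Lemma potential_step w v z z' :
  momentum_step G H w v z -> momentum_step G H v z z' ->
  1 / 9 * (sqn (G z) + sqn (H z)) + potential v z z' <= potential w v z.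
Proof.
move=> [prevx prevy] step; have [stepx stepy] := step.
have := energy_step _ _ _ step.
have := potential_form (v.1 - w.1) (z.1 - v.1) (z'.1 - z.1).
have := potential_form (v.2 - w.2) (z.2 - v.2) (z'.2 - z.2).
rewrite (gradient_difference _ _ _ _ _ prevx stepx).
rewrite -(opprK (H (z.1, v.2))) in prevy; rewrite -(opprK (H (z'.1, z.2))) in stepy.
rewrite (gradient_difference _ _ _ _ _ prevy stepy).
have -> : sqn (z'.1 - z.1 + (1 / 2) *: (z.1 - v.1)) = sqn (G z).
  by rewrite stepx addrAC addNr add0r sqnN.
have -> : sqn (z'.2 - z.2 + (1 / 2) *: (z.2 - v.2)) = sqn (H (z'.1, z.2)).
  by rewrite stepy addrAC addNr add0r !sqnN.
have := lipschitz_G v z.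
have := lipschitz_H (z.1, v.2) (z'.1, z.2).
have := lipschitz_H z (z'.1, z.2).
have := sqn_le_near (H z) (H (z'.1, z.2)).
have := sqn_ge0 (G z); have := sqn_ge0 (z.1 - v.1); have := sqn_ge0 (z'.2 - z.2).
rewrite -opprD sqnN /potential /sqn2 /= subrr sqn0.
rewrite -(opprB z.1 v.1) -(opprB z'.1 z.1) -(opprB z.2 v.2) !sqnN.
lra.
Qed.

(** [phi z - phi zs] is at most [1/5] of the squared distance of [z] to the saddle;
passing from that distance to the averaged one costs [|z - v|^2], which the
potential contains. *)
Lemma potential_ge0 w v z : 0 <= potential w v z.
Proof.
have low := phi_le_saddle z.2.
have := oracle_convex oracle z.1 zs.1 z.2.
have := dot_le (G z) (z.1 - zs.1).
have := grad_le z; have := sqn_ge0 (H z).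
rewrite -surjective_pairing -(opprB z.1 zs.1) dotNr /potential /energy.
rewrite /averaged_dist /sqn2 /=.
set ex := z.1 - _ - zs.1; set ey := z.2 - _ - zs.2.
have -> : z.1 - zs.1 = ex + (1 / 3) *: (z.1 - v.1).
  by rewrite /ex addrAC subrK.
have -> : z.2 - zs.2 = ey + (1 / 3) *: (z.2 - v.2).
  by rewrite /ey addrAC subrK.
have := sqn_ge0 (v.1 - w.1); have := sqn_ge0 (v.2 - w.2).
set Bx := z.1 - v.1; set By := z.2 - v.2.
(* [2/15] is the weight [2/3] of [phi] in [energy] times the constant [1/5]. *)
have young n (e B : 'rV[R]_n) :
    2 / 15 * sqn (e + (1 / 3) *: B) <= sqn e + 1 / 10 * sqn B.
  have := sqn_ge0 (e - (1 / 2) *: B); have := sqn_ge0 e; have := sqn_ge0 B.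
  by rewrite /sqn !dotE (dotC B e); lra.
have := young _ ex Bx; have := young _ ey By.
have := sqn_ge0 (ey + (1 / 3) *: By).
lra.
Qed.

(** Without momentum the averaged point is [z] itself; [phi zs - phi z] is at most
[1/5] of the squared distance, whence [17/15 = 1 + 2/3 * 1/5]. *)
Lemma energy_start z : energy z z <= 17 / 15 * sqn2 (z - zs).
Proof.
rewrite /energy /averaged_dist !subrr !scaler0 !subr0.
have low := phi_ge_saddle z.1.
have := oracle_concave oracle z.1 z.2 zs.2.
have := dot_le (H z) (zs.2 - z.2).
have := grad_le z; have := sqn_ge0 (G z); have := sqn_ge0 (z.1 - zs.1).
rewrite -!surjective_pairing -(opprB z.2 zs.2) sqnN /sqn2 /=; lra.
Qed.

(** The first step has no previous gradient to compare with, so it is bounded through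
the distance to the saddle, where the gradient vanishes. *)
Lemma potential_first z z' : momentum_step G H z z z' ->
  1 / 9 * (sqn (G z) + sqn (H z)) + potential z z z' <= 4 / 3 * sqn2 (z - zs).
Proof.
move=> step; have := energy_step _ _ _ step; case: step.
rewrite /potential /energy_rate /sqn2 /= !subrr !scaler0 !oppr0 !add0r.
rewrite !dot0l !sqn0 => stepx stepy.
have := energy_start z; have := grad_le z; have := grad_le (z'.1, z.2).
have := sqn_ge0 (G z); have := sqn_ge0 (H z); have := sqn_ge0 (G (z'.1, z.2)).
have : sqn (z'.1 - zs.1) <= 2 * sqn (z.1 - zs.1) + 2 * sqn (G z).
  have -> : z'.1 - zs.1 = z.1 - zs.1 - G z.
    by rewrite -stepx [RHS]addrC subrKA.
  exact: sqnB_le.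
have := sqn_ge0 (z.1 - zs.1); have := sqn_ge0 (z.2 - zs.2).
rewrite stepx stepy sqnN /sqn2 /=; lra.
Qed.

(** Since [0.-1 = 0], the hypothesis at [t = 0] is a step without momentum, which is
what [potential_first] requires; later steps telescope. *)
Lemma sum_grad_le (z : nat -> 'rV[R]_dx * 'rV[R]_dy) (T : nat) :
  (forall t, momentum_step G H (z t.-1) (z t) (z t.+1)) ->
  \sum_(0 <= t < T.+1) (sqn (G (z t)) + sqn (H (z t))) <= 12 * sqn2 (z 0%N - zs).
Proof.
move=> step.
suff: 1 / 9 * \sum_(0 <= t < T.+1) (sqn (G (z t)) + sqn (H (z t)))
      + potential (z T.-1) (z T) (z T.+1) <= 4 / 3 * sqn2 (z 0%N - zs).
  by have := potential_ge0 (z T.-1) (z T) (z T.+1); lra.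
elim: T => [|T IH]; first by rewrite big_nat1; exact: (potential_first _ _ (step 0%N)).
have := potential_step _ _ _ _ (step T) (step T.+1).
by rewrite big_nat_recr //=; lra.
Qed.
End Oracle.

(** * Application to alternating gradient descent-ascent *)

(** The statements about the second variable are those about the first for the convex
function [- f (x, .)]. *)
Lemma scaled_oracle {R : realType} {dx dy : nat} (L : R)
    (f : 'rV[R]_dx * 'rV[R]_dy -> R) (zs : 'rV[R]_dx * 'rV[R]_dy) (eta : R) :
  0 < L -> smooth L f -> convex_concave f -> saddle_point f zs ->
  eta = 1 / (5 * L) ->
  saddle_oracle (fun z => eta * f z) (fun z => eta *: grad_x f z)
    (fun z => eta *: grad_y f z) zs.
Proof.
move=> L0 [fd fL] [fx fy] fs etaE.
have eta0 : 0 < eta by rewrite etaE divr_gt0 // mulr_gt0.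
have dfx x y : differentiable (fun x => f (x, y)) x.
  have inj : differentiable (fun x : 'rV[R]_dx => (id x, cst y x)) x.
    by apply: differentiable_pair.
  exact: (differentiable_comp inj (fd (x, y))).
have dfy x y : differentiable (fun y => f (x, y)) y.
  have inj : differentiable (fun y : 'rV[R]_dy => (cst x y, id y)) y.
    by apply: differentiable_pair.
  exact: (differentiable_comp inj (fd (x, y))).
have gradN x y : gradient (fun y => - f (x, y)) y = - grad_y f (x, y).
  apply/rowP => i; rewrite !mxE; apply: deriveN; exact: diff_derivable.
split=> [x x' y|x y y'|a b|].
- rewrite dotZl -mulrBr ler_pM2l //.
  exact: (gradient_convex (fun x => f (x, y))).
- rewrite dotZl -mulrBr ler_pM2l //.
  have := gradient_convex _ _ y' (fy x) (differentiableN (dfy x y)).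
  by rewrite gradN dotNl /=; lra.
- rewrite -!scalerBr /sqn !dotZl !dotZr !mulrA -!expr2 -mulrDr.
  have e0 u : 0 <= @enorm2 R dx dy u by rewrite sqrtr_ge0.
  have := fL a b; rewrite -ler_sqr ?nnegrE ?mulr_ge0 ?(ltW L0) //.
  rewrite exprMn !enorm2_sqr => h.
  have -> : 1 / 25 * sqn2 (a - b) = eta ^+ 2 * (L ^+ 2 * sqn2 (a - b)).
    by rewrite etaE; field; rewrite gt_eqF.
  by rewrite ler_pM2l ?exprn_gt0.
- split.
    rewrite /grad_x gradient_min ?scaler0 // => x.
    by rewrite -surjective_pairing; case: (fs x zs.2).
  rewrite [zs in grad_y f zs]surjective_pairing -[grad_y f _]opprK -gradN.
  rewrite gradient_min ?oppr0 ?scaler0 // => [y|]; last exact: differentiableN.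
  by rewrite -surjective_pairing lerN2; case: (fs zs.1 y).
Qed.

Theorem theorem3p1 (R : realType) (dx dy : nat) (L : R) (L_gt0 : 0 < L)
    (f : 'rV[R]_dx * 'rV[R]_dy -> R)
    (f_smooth : smooth L f) (f_cc : convex_concave f)
    (zs : 'rV[R]_dx * 'rV[R]_dy) (zs_saddle : saddle_point f zs)
    (eta beta : R) (etaE : eta = 1 / (5 * L)) (betaE : beta = - (1 / 2))
    (z0 : 'rV[R]_dx * 'rV[R]_dy) (z : nat -> 'rV[R]_dx * 'rV[R]_dy)
    (z_init : z 0%N = z0) (z_iter : alt_gda_momentum f eta beta z)
    (T : nat) (T_ge1 : (1 <= T)%N) :
  1 / T%:R * (\sum_(0 <= t < T) enorm2 (grad f (z t)) ^+ 2)
    <= 12 * enorm2 (z0 - zs) ^+ 2 / (eta ^+ 2 * T%:R).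
Proof.
have eta0 : 0 < eta by rewrite etaE divr_gt0 // mulr_gt0.
have oracle := scaled_oracle _ _ _ _ L_gt0 f_smooth f_cc zs_saddle etaE.
have step t : momentum_step (fun z => eta *: grad_x f z)
    (fun z => eta *: grad_y f z) (z t.-1) (z t) (z t.+1).
  have [zx zy] := z_iter t; split.
    by rewrite zx betaE scaleNr; apply/rowP => i; rewrite !mxE; lra.
  by rewrite zy betaE scaleNr; apply/rowP => i; rewrite !mxE; lra.
case: T T_ge1 => // T _; have := sum_grad_le _ _ _ _ oracle z T step.
have -> : \sum_(0 <= t < T.+1) (sqn (eta *: grad_x f (z t))
      + sqn (eta *: grad_y f (z t)))
    = eta ^+ 2 * \sum_(0 <= t < T.+1) enorm2 (grad f (z t)) ^+ 2.
  rewrite mulr_sumr; apply: eq_bigr => t _.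
  by rewrite enorm2_sqr /sqn !dotZl !dotZr; ring.
rewrite z_init enorm2_sqr -/(sqn2 _) => bound.
have T0 : 0 < T.+1%:R :> R by rewrite ltr0n.
rewrite ler_pdivlMr ?mulr_gt0 ?exprn_gt0 //.
by apply: le_trans bound; rewrite le_eqVlt; apply/orP; left; apply/eqP; field; rewrite gt_eqF.
Qed.
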